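(* Let $F$ be a field of characteristic $\ell\neq 2$, let $n\geq 2$ be even, and let $f:V\times V\to F$ be a bilinear form on a finite dimensional $F$-vector space $V$ having Gram matrix $A_n(1)=\begin{pmatrix}0&I_n\\ J_n(1)&0\end{pmatrix}$ relative to some basis of $V$. Then $L(f)$ has dimension $2n$ and is isomorphic to the current truncated Lie algebra $\mathfrak{gl}(2,F)\otimes F[X]/(X^{n/2})$. In particular, $L(f)$ is reductive if and only if $n=2$. Moreover, let $W=\ker(\sigma^{+-})^2$ and set $$K=\{x\in L(f)\mid xV\subseteq W\text{ and } xW=0\}.$$ Then $K$ is an abelian ideal of $L(f)$, not contained in the center of $L(f)$ provided $n>2$.
   Context: $L(f)=\{x\in\mathfrak{gl}(V)\mid f(xv,w)=-f(v,xw)\ \text{for all } v,w\in V\}$. A Lie algebra is called reductive if every solvable ideal is central. $J_n(\lambda)$ is the $n\times n$ lower triangular Jordan block with eigenvalue $\lambda$. The bracket on $\mathfrak{g}\otimes F[X]/(X^k)$ is $[a\otimes p,b\otimes q]=[a,b]\otimes pq$. Set $f^{+}(u,v)=f(u,v)+f(v,u)$ and $f^{-}(u,v)=f(u,v)-f(v,u)$. In the present situation $f^+$ is non-degenerate, and $\sigma^{+-}\in\mathrm{End}(V)$ denotes the unique endomorphism such that $f^-(u,v)=f^+(u,\sigma^{+-}v)$ for all $u,v\in V$. *)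

(* Defs.v *)
From HB Require Import structures.
From mathcomp Require Import all_boot all_algebra.

Set Implicit Arguments.
Unset Strict Implicit.
Unset Printing Implicit Defensive.

Import GRing.Theory VectorInternalTheory.
Local Open Scope ring_scope.

HB.mixin Record Vector_isLie (F : fieldType) L of Vector F L := {
  bracket : L -> L -> L;
  bracket_linearl : forall y, linear (bracket^~ y);
  bracket_linearr : forall x, linear (bracket x);
  bracketxx : forall x, bracket x x = 0;
  bracket_jacobi : forall x y z,
    bracket x (bracket y z) + bracket y (bracket z x)
      + bracket z (bracket x y) = 0 }.

#[short(type="lieAlgType")]
HB.structure Definition LieAlg (F : fieldType) :=
  { L of Vector_isLie F L & Vector F L }.

Notation "[ 'Lie' x , y ]" := (bracket x y)
  (at level 0, x, y at level 99, format "[ 'Lie'  x ,  y ]") : ring_scope.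

Section LieTheory.
Variables (F : fieldType) (L : lieAlgType F).
Implicit Types (x y z : L) (U V I : {vspace L}).

Lemma bracketDl x y z : [Lie x + y, z] = [Lie x, z] + [Lie y, z].
Proof. by have := bracket_linearl z 1 x y; rewrite !scale1r. Qed.

Lemma bracketDr x y z : [Lie x, y + z] = [Lie x, y] + [Lie x, z].
Proof. by have := bracket_linearr x 1 y z; rewrite !scale1r. Qed.

Lemma bracket0l x : [Lie 0, x] = 0.
Proof. by apply: (addrI [Lie 0, x]); rewrite -bracketDl !addr0. Qed.

Lemma bracket0r x : [Lie x, 0] = 0.
Proof. by apply: (addrI [Lie x, 0]); rewrite -bracketDr !addr0. Qed.

Lemma bracketZl a x y : [Lie a *: x, y] = a *: [Lie x, y].
Proof. by have := bracket_linearl y a x 0; rewrite bracket0l !addr0. Qed.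

Lemma bracketZr a x y : [Lie x, a *: y] = a *: [Lie x, y].
Proof. by have := bracket_linearr x a y 0; rewrite bracket0r !addr0. Qed.

Lemma bracketC x y : [Lie x, y] = - [Lie y, x].
Proof.
apply/eqP; rewrite -addr_eq0; apply/eqP.
by have := bracketxx (x + y); rewrite bracketDl !bracketDr !bracketxx addr0 add0r.
Qed.

Lemma bracket_suml (I : Type) (r : seq I) (P : pred I) (E : I -> L) y :
  [Lie \sum_(i <- r | P i) E i, y] = \sum_(i <- r | P i) [Lie E i, y].
Proof.
by apply: (big_morph (bracket^~ y)) => [u v|]; rewrite ?bracketDl ?bracket0l.
Qed.

Lemma bracket_sumr (I : Type) (r : seq I) (P : pred I) (E : I -> L) x :
  [Lie x, \sum_(i <- r | P i) E i] = \sum_(i <- r | P i) [Lie x, E i].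
Proof.
by apply: (big_morph (bracket x)) => [u v|]; rewrite ?bracketDr ?bracket0r.
Qed.

Definition lie_prod U V : {vspace L} :=
  <<[seq [Lie u, v] | u <- vbasis U, v <- vbasis V]>>%VS.

Lemma lie_prodP U V (W : {vspace L}) :
  reflect (forall u v, u \in U -> v \in V -> [Lie u, v] \in W)
          (lie_prod U V <= W)%VS.
Proof.
apply: (iffP span_subvP) => [sUV u v uU vV|sUV w /allpairsP[[u v] /= [uU vV ->]]].
  rewrite (coord_vbasis uU) (coord_vbasis vV) bracket_suml rpred_sum // => i _.
  rewrite bracketZl bracket_sumr rpredZ // rpred_sum // => j _.
  by rewrite bracketZr rpredZ // sUV // allpairs_f // mem_nth // size_tuple.
by apply: sUV; apply: vbasis_mem.
Qed.

Definition derived_series U k : {vspace L} := iter k (fun W => lie_prod W W) U.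

Definition lie_solvable U := exists k, derived_series U k = 0%VS.

Definition lie_abelian U := forall x y, x \in U -> y \in U -> [Lie x, y] = 0.

Definition lie_ideal I := forall x y, y \in I -> [Lie x, y] \in I.

Definition lie_central U := forall x y, x \in U -> [Lie x, y] = 0.

End LieTheory.

Definition reductive (F : fieldType) (L : lieAlgType F) :=
  forall I : {vspace L}, lie_ideal I -> lie_solvable I -> lie_central I.

Definition lie_isomorphic (F : fieldType) (L M : lieAlgType F) :=
  exists phi : 'Hom(L, M),
    bijective phi /\ {morph phi : x y / [Lie x, y] >-> [Lie x, y]}.

Fact jacobi_sum (Z : zmodType) (a b c d e f : Z) :
  (a - b - (c - d)) + (c - e - (f - b)) + (f - d - (a - e)) = 0.
Proof.
have regroup (x y z t : Z) : x - y - (z - t) = (t + x) - (y + z).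
  by rewrite opprB addrACA [x + t]addrC -opprD.
by rewrite !regroup (addrC b c) (addrC e f) subrKA (addrC d) subrKA subrr.
Qed.

Section GlEnd.
Variables (F : fieldType) (V : vectType F).
Implicit Types x y z : 'End(V).

Definition commutator x y : 'End(V) := ((x \o y) - (y \o x))%VF.

Lemma commutatorE x y v : commutator x y v = x (y v) - y (x v).
Proof. by rewrite /commutator add_lfunE opp_lfunE !comp_lfunE. Qed.

Fact commutator_linearl y : linear (commutator^~ y).
Proof.
move=> a u v; rewrite /commutator comp_lfunDl comp_lfunDr -comp_lfunZl -comp_lfunZr.
by rewrite scalerBr opprD addrACA.
Qed.

Fact commutator_linearr x : linear (commutator x).
Proof.
move=> a u v; rewrite /commutator comp_lfunDl comp_lfunDr -comp_lfunZl -comp_lfunZr.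
by rewrite scalerBr opprD addrACA.
Qed.

Fact commutatorxx x : commutator x x = 0.
Proof. exact: subrr. Qed.

Fact commutator_jacobi x y z :
  commutator x (commutator y z) + commutator y (commutator z x)
    + commutator z (commutator x y) = 0.
Proof.
have linB (g : 'End(V)) a b : g (a - b) = g a - g b by rewrite linearB.
apply/lfunP=> v; rewrite 2!add_lfunE !commutatorE !linB zero_lfunE.
exact: jacobi_sum.
Qed.

HB.instance Definition _ := Vector_isLie.Build F 'End(V)
  commutator_linearl commutator_linearr commutatorxx commutator_jacobi.

End GlEnd.

Section GlMatrix.
Variables (F : fieldType) (n : nat).
Implicit Types A B C : 'M[F]_n.

Definition mx_commutator A B : 'M[F]_n := A *m B - B *m A.

Fact mx_commutator_linearl B : linear (mx_commutator^~ B).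
Proof.
move=> a A C; rewrite /mx_commutator mulmxDl mulmxDr -scalemxAl -scalemxAr.
by rewrite scalerBr opprD addrACA.
Qed.

Fact mx_commutator_linearr A : linear (mx_commutator A).
Proof.
move=> a B C; rewrite /mx_commutator mulmxDl mulmxDr -scalemxAl -scalemxAr.
by rewrite scalerBr opprD addrACA.
Qed.

Fact mx_commutatorxx A : mx_commutator A A = 0.
Proof. exact: subrr. Qed.

Fact mx_commutator_jacobi A B C :
  mx_commutator A (mx_commutator B C) + mx_commutator B (mx_commutator C A)
    + mx_commutator C (mx_commutator A B) = 0.
Proof.
rewrite /mx_commutator !mulmxBl !mulmxBr !mulmxA.
exact: jacobi_sum.
Qed.

HB.instance Definition _ := Vector_isLie.Build F 'M[F]_n
  mx_commutator_linearl mx_commutator_linearr mx_commutatorxx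
  mx_commutator_jacobi.

End GlMatrix.

(* Tensor products of finite-dimensional vector spaces: an element of       *)
(* tensor V W is the matrix of its coordinates in the basis                  *)
(* vunit i (x) vunit j, which is the basis used by v2r and r2v.              *)
Section VectorUnits.
Variables (F : fieldType) (V : vectType F).

Definition vunit (i : 'I_(dim V)) : V := r2v (delta_mx 0 i).

Lemma vunit_sum v : v = \sum_i v2r v 0 i *: vunit i.
Proof.
rewrite -[LHS]v2rK [v2r v in LHS]row_sum_delta linear_sum.
by apply: eq_bigr => i _; rewrite linearZ.
Qed.

End VectorUnits.

Section Tensor.
Variables (F : fieldType) (V W : vectType F).

Definition tensor : Type := 'M[F]_(dim V, dim W).
HB.instance Definition _ := Vector.on tensor.

Definition tens (v : V) (w : W) : tensor := (v2r v)^T *m v2r w.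

Fact tens_bilinear : bilinear_for *:%R *:%R tens.
Proof.
split=> [w|v] a x y; rewrite /tens linearP.
  by rewrite linearP mulmxDl -scalemxAl.
by rewrite mulmxDr -scalemxAr.
Qed.
HB.instance Definition _ :=
  bilinear_isBilinear.Build F V W tensor *:%R *:%R tens tens_bilinear.

Lemma tensor_sum (t : tensor) :
  t = \sum_i \sum_j t i j *: tens (vunit i) (vunit j).
Proof.
rewrite [LHS]matrix_sum_delta; apply: eq_bigr => i _; apply: eq_bigr => j _.
by congr (_ *: _); rewrite /tens !r2vK trmx_delta mul_delta_mx.
Qed.

Section Lift.
Variables (Z : vectType F) (b : V -> W -> Z).

Definition tensor_lift (t : tensor) : Z :=
  \sum_i \sum_j t i j *: b (vunit i) (vunit j).

Fact tensor_lift_linear : linear tensor_lift.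
Proof.
move=> a s t; rewrite /tensor_lift scaler_sumr -big_split /=.
apply: eq_bigr => i _; rewrite scaler_sumr -big_split /=; apply: eq_bigr => j _.
by rewrite !mxE scalerDl scalerA.
Qed.
HB.instance Definition _ :=
  GRing.isLinear.Build F tensor Z _ tensor_lift tensor_lift_linear.

End Lift.

Lemma tensor_liftE (Z : vectType F) (b : {bilinear V -> W -> Z}) v w :
  tensor_lift b (tens v w) = b v w.
Proof.
rewrite [in RHS](vunit_sum v) [in RHS](vunit_sum w) linear_sumlz.
apply: eq_bigr => i _; rewrite linearZl_LR linear_sumr scaler_sumr.
apply: eq_bigr => j _; rewrite linearZr_LR scalerA; congr (_ *: _).
by rewrite mxE big_ord1 mxE.
Qed.

Lemma tensor_universal (Z : vectType F) (b : {bilinear V -> W -> Z}) :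
  exists2 phi : 'Hom(tensor, Z), forall v w, phi (tens v w) = b v w &
    forall psi : 'Hom(tensor, Z), (forall v w, psi (tens v w) = b v w) ->
      psi = phi.
Proof.
exists (linfun (tensor_lift b)) => [v w|psi psiE].
  by rewrite lfunE /= tensor_liftE.
apply/lfunP=> t; rewrite lfunE /= [in LHS](tensor_sum t) linear_sum.
apply: eq_bigr => i _; rewrite linear_sum; apply: eq_bigr => j _.
by rewrite linearZ /= psiE.
Qed.

Lemma tensor_ind (P : tensor -> Prop) :
    (forall v w, P (tens v w)) -> (forall s t, P s -> P t -> P (s + t)) ->
  forall t, P t.
Proof.
move=> Ptens PD t; have P0 : P 0 by have := Ptens 0 0; rewrite linear0l.
rewrite (tensor_sum t).
apply: big_ind => // i _; apply: big_ind => // j _.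
by rewrite -linearZl_LR; apply: Ptens.
Qed.

End Tensor.

(* The truncated current algebra g (x) F[X]/(X^k), for k > 0: the library    *)
(* reads {poly %/ 'X^0} as {poly %/ 'X}.                                     *)
Section Current.
Variables (F : fieldType) (g : lieAlgType F) (k : nat).
Local Notation A := {poly %/ ('X^k : {poly F})}.

Definition current : Type := tensor g A.
HB.instance Definition _ := Vector.on current.
Implicit Types s t u : current.

Definition current_tens_bracket (a : g) (p : A) (b : g) (q : A) : current :=
  tens [Lie a, b] (p * q).

Fact current_tens_bracket_bilinear a p :
  bilinear_for *:%R *:%R (current_tens_bracket a p).
Proof.
rewrite /current_tens_bracket; split=> [q|b] c x y.
  by rewrite bracket_linearr linearPl.
by rewrite mulrDr -scalerAr linearPr.
Qed.
HB.instance Definition _ a p :=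
  bilinear_isBilinear.Build F g A current *:%R *:%R (current_tens_bracket a p)
    (current_tens_bracket_bilinear a p).

Definition current_act (t : current) (a : g) (p : A) : current :=
  tensor_lift (current_tens_bracket a p) t.

Fact current_act_bilinear t : bilinear_for *:%R *:%R (current_act t).
Proof.
rewrite /current_act /tensor_lift.
split=> [p|a] c x y /=; rewrite scaler_sumr -big_split /=; apply: eq_bigr => i _;
  rewrite scaler_sumr -big_split /=; apply: eq_bigr => j _;
  rewrite scalerA mulrC -scalerA -scalerDr; congr (_ *: _);
  rewrite /current_tens_bracket.
  by rewrite bracket_linearl linearPl.
by rewrite mulrDl -scalerAl linearPr.
Qed.
HB.instance Definition _ t :=
  bilinear_isBilinear.Build F g A current *:%R *:%R (current_act t)
    (current_act_bilinear t).

Definition current_bracket s t : current := tensor_lift (current_act t) s.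

Lemma current_bracket_tens (a b : g) (p q : A) :
  current_bracket (tens a p) (tens b q) = tens [Lie a, b] (p * q).
Proof. by rewrite /current_bracket tensor_liftE [LHS]tensor_liftE. Qed.

Fact current_linearl t : linear (current_bracket^~ t).
Proof. by move=> c x y; rewrite /current_bracket linearP. Qed.

Fact current_linearr s : linear (current_bracket s).
Proof.
move=> c x y; rewrite /current_bracket /tensor_lift scaler_sumr -big_split /=.
apply: eq_bigr => i _; rewrite scaler_sumr -big_split /=; apply: eq_bigr => j _.
rewrite scalerA mulrC -scalerA -scalerDr; congr (_ *: _).
exact: linearP.
Qed.

Fact currentDl s t u :
  current_bracket (s + t) u = current_bracket s u + current_bracket t u.
Proof. by have := current_linearl u 1 s t; rewrite !scale1r. Qed.

Fact currentDr s t u :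
  current_bracket s (t + u) = current_bracket s t + current_bracket s u.
Proof. by have := current_linearr s 1 t u; rewrite !scale1r. Qed.

Fact currentC s t : current_bracket s t = - current_bracket t s.
Proof.
elim/tensor_ind: s t => [a p|s1 s2 IH1 IH2] t; last first.
  by rewrite currentDl currentDr opprD IH1 IH2.
elim/tensor_ind: t => [b q|t1 t2 IH1 IH2]; last first.
  by rewrite currentDl currentDr opprD IH1 IH2.
by rewrite !current_bracket_tens bracketC linearNl mulrC.
Qed.

Fact currentxx s : current_bracket s s = 0.
Proof.
elim/tensor_ind: s => [a p|s t IHs IHt].
  by rewrite current_bracket_tens bracketxx linear0l.
by rewrite currentDl !currentDr IHs IHt add0r addr0 currentC addNr.
Qed.

Fact current_jacobi s t u :
  current_bracket s (current_bracket t u)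
    + current_bracket t (current_bracket u s)
    + current_bracket u (current_bracket s t) = 0.
Proof.
have addJ (a b c a' b' c' : current) : a + b + c = 0 -> a' + b' + c' = 0 ->
    (a + a') + (b + b') + (c + c') = 0.
  by move=> e1 e2; rewrite (addrACA a a' b b') (addrACA (a + b)) e1 e2 addr0.
elim/tensor_ind: s t u => [a p|s1 s2 IH1 IH2] t u; last first.
  by rewrite !(currentDl, currentDr); apply: addJ.
elim/tensor_ind: t u => [b q|t1 t2 IH1 IH2] u; last first.
  by rewrite !(currentDl, currentDr); apply: addJ.
elim/tensor_ind: u => [c r|u1 u2 IH1 IH2]; last first.
  by rewrite !(currentDl, currentDr); apply: addJ.
rewrite !current_bracket_tens.
have -> : q * (r * p) = p * (q * r) by rewrite mulrA mulrC.
have -> : r * (p * q) = p * (q * r) by rewrite mulrC mulrA.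
by rewrite -!linearDl bracket_jacobi linear0l.
Qed.

HB.instance Definition _ := Vector_isLie.Build F current
  current_linearl current_linearr currentxx current_jacobi.

End Current.

Section Skew.
Variables (F : fieldType) (V : vectType F) (f : {biscalar V}).
Implicit Types (x y : 'End(V)) (u v w : V).

Definition skew_defect x : 'M[F]_(\dim {:V}) :=
  \matrix_(i, j) (f (x (vbasis {:V})`_i) (vbasis {:V})`_j
                  + f (vbasis {:V})`_i (x (vbasis {:V})`_j)).

Fact skew_defect_linear : linear skew_defect.
Proof.
move=> a x y; apply/matrixP=> i j; rewrite !mxE !add_lfunE !scale_lfunE.
by rewrite linearPl linearPr mulrDr addrACA.
Qed.
HB.instance Definition _ :=
  GRing.isLinear.Build F 'End(V) 'M[F]_(\dim {:V}) _ skew_defect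
    skew_defect_linear.

(* L(f) as a subspace of gl(V); see skew_spaceP. *)
Definition skew_space : {vspace 'End(V)} := lker (linfun skew_defect).

Lemma skew_spaceP x :
  reflect (forall v w, f (x v) w = - f v (x w)) (x \in skew_space).
Proof.
rewrite memv_ker lfunE /=; apply: (iffP eqP) => [x0 v w|skx]; last first.
  by apply/matrixP=> i j; rewrite !mxE skx addNr.
have ve u := coord_vbasis (memvf u).
have defect_l (j : 'I_(\dim {:V})) u :
    f (x u) (vbasis {:V})`_j + f u (x (vbasis {:V})`_j) = 0.
  rewrite {1 2}(ve u) linear_sum !linear_sumlz -big_split big1 //= => i _.
  rewrite linearZ !linearZl_LR /= -mulrDr.
  by move/matrixP/(_ i j): x0; rewrite !mxE => ->; rewrite mulr0.
apply/eqP; rewrite -addr_eq0 {1 2}(ve w) !linear_sum -big_split.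
rewrite big1 //= => j _.
by rewrite !linearZ /= -mulrDr defect_l mulr0.
Qed.

Fact skew_space_bracket x y :
  x \in skew_space -> y \in skew_space -> [Lie x, y] \in skew_space.
Proof.
move=> /skew_spaceP skx /skew_spaceP sky; apply/skew_spaceP=> v w.
by rewrite !commutatorE linearBl linearBr !(skx, sky) !opprK opprB addrC.
Qed.

(* L(f) as a Lie algebra, with the bracket of gl(V). *)
Definition skew_lie : Type := subvs_of skew_space.
HB.instance Definition _ := Vector.on skew_lie.
Implicit Types a b c : skew_lie.

Definition skew_bracket a b : skew_lie :=
  vsproj skew_space [Lie vsval a, vsval b].

Lemma skew_bracketE a b : vsval (skew_bracket a b) = [Lie vsval a, vsval b].
Proof. by rewrite vsprojK // skew_space_bracket // subvsP. Qed.

Fact skew_bracket_linearl b : linear (skew_bracket^~ b).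
Proof.
move=> k a c; apply: subvs_inj; rewrite linearP /= !skew_bracketE linearP.
exact: bracket_linearl.
Qed.

Fact skew_bracket_linearr a : linear (skew_bracket a).
Proof.
move=> k b c; apply: subvs_inj; rewrite linearP /= !skew_bracketE linearP.
exact: bracket_linearr.
Qed.

Fact skew_bracketxx a : skew_bracket a a = 0.
Proof. by apply: subvs_inj; rewrite skew_bracketE bracketxx linear0. Qed.

Fact skew_bracket_jacobi a b c :
  skew_bracket a (skew_bracket b c) + skew_bracket b (skew_bracket c a)
    + skew_bracket c (skew_bracket a b) = 0.
Proof.
by apply: subvs_inj; rewrite [RHS]linear0 !linearD /= !skew_bracketE bracket_jacobi.
Qed.

HB.instance Definition _ := Vector_isLie.Build F skew_lie
  skew_bracket_linearl skew_bracket_linearr skew_bracketxx skew_bracket_jacobi.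

Section Annihilating.
Variable W : {vspace V}.

Definition outside_part a : 'End(V) := ((\1 - projv W) \o vsval a)%VF.
Definition inside_part a : 'End(V) := (vsval a \o projv W)%VF.

Fact outside_part_linear : linear outside_part.
Proof.
by move=> k a b; rewrite /outside_part linearP comp_lfunDr -comp_lfunZr.
Qed.
HB.instance Definition _ :=
  GRing.isLinear.Build F skew_lie 'End(V) _ outside_part outside_part_linear.

Fact inside_part_linear : linear inside_part.
Proof.
by move=> k a b; rewrite /inside_part linearP comp_lfunDl -comp_lfunZl.
Qed.
HB.instance Definition _ :=
  GRing.isLinear.Build F skew_lie 'End(V) _ inside_part inside_part_linear.

(* {x in L(f) | xV <= W, xW = 0}, written with kernels to get a subspace;    *)
(* see skew_to_killP.                                                        *)
Definition skew_to_kill : {vspace skew_lie} :=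
  (lker (linfun outside_part) :&: lker (linfun inside_part))%VS.

Lemma skew_to_killP a :
  reflect ((forall v, vsval a v \in W) /\ (forall w, w \in W -> vsval a w = 0))
          (a \in skew_to_kill).
Proof.
rewrite memv_cap !memv_ker !lfunE /=.
apply: (iffP andP) => [[/eqP out0 /eqP in0]|[aW aW0]].
  split=> [v|w wW]; last first.
    have /lfunP/(_ w) := in0.
    by rewrite zero_lfunE comp_lfunE projv_id.
  have /lfunP/(_ v) := out0; rewrite zero_lfunE comp_lfunE add_lfunE opp_lfunE.
  by rewrite id_lfunE => /eqP; rewrite subr_eq0 => /eqP ->; apply: memv_proj.
split; apply/eqP/lfunP=> v; rewrite zero_lfunE comp_lfunE.
  by rewrite add_lfunE opp_lfunE id_lfunE projv_id ?subrr.
exact/aW0/memv_proj.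
Qed.

End Annihilating.

Definition fplus u v : F := f u v + f v u.
Definition fminus u v : F := f u v - f v u.

(* The defining property of sigma^{+-}. *)
Definition is_sigma (s : 'End(V)) := forall u v, fminus u v = fplus u (s v).

End Skew.

Section Gram.
Variables (F : fieldType) (n : nat) (lambda : F).

Definition jordan_lower : 'M[F]_n :=
  \matrix_(i, j) (lambda *+ (i == j) + (i == j.+1 :> nat)%:R).

Definition gram_A : 'M[F]_(n + n) := block_mx 0 1%:M jordan_lower 0.

End Gram.

(* Main.v *)
Require Import Defs.
From HB Require Import structures.
From mathcomp Require Import all_boot all_algebra.
From mathcomp Require Import ring zify.

Set Implicit Arguments.
Unset Strict Implicit.
Unset Printing Implicit Defensive.

Import GRing.Theory.
Local Open Scope ring_scope.

(** The idea is to see V as a free module of rank 2 over F[X]/(X^n), on which X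
    acts as sigma^{+-} and for which f^+ becomes skew-hermitian with respect to
    the involution X |-> - X.

    An operator in L(f) is skew for both f^+ and f^- = f^+(., sigma .); as f^+
    is non-degenerate, it commutes with sigma.  So L(f) consists of the
    F[X]/(X^n)-linear operators that are skew for f^+.  Suppose that V has a
    basis over F[X]/(X^n) in which f^+(w, w') is the coefficient of X^(n-1) in
    w0^* w1' - w1^* w0', where p^*(X) = p(-X).  Then the 2 x 2 matrices U in
    L(f) are those with U00^* = - U11, U01^* = U01 and U10^* = U10, that is

       U = A(X^2) h + X B(X^2) 1 + C(X^2) e + D(X^2) g,

    where h, e, g is the standard basis of sl2.  As 2 is invertible, gl2 is the
    direct sum of sl2 and the scalar matrices, so sending M (x) p to
    p(X^2) (M_0 + (tr M / 2) X), with M_0 the traceless part of M, is an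
    isomorphism from gl(2) (x) F[X]/(X^(n/2)) onto L(f): the scalar part is
    central on both sides, and X^n = (X^2)^(n/2).  The parity of n enters here:
    it makes n - 1 odd, so that a symmetric f^+ gives a skew-hermitian form.

    It remains to find such a basis (gram_chart_model).  If the two halves of
    the given basis are the powers 1, X, X^2, and so on, the second half in
    reverse order, then f((P, Q), (P', Q')) is the coefficient of X^(n-1) in
    P Q' + (1 + X) Q P', by form_gram_sum.  Hence f^+ is given by the weight
    2 + X, and sigma acts as Y on the first half and as - Y on the second, with
    Y = X / (2 + X).  In the coordinate Y this becomes the normal form above,
    once the second coordinate is multiplied by a unit.  The unit comes from
    Lagrange inversion: coef_residue says that the coefficient of Y^(n-1) in a
    series is the coefficient of X^(n-1) in 2 (2 + X)^(n-2) times this series.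

    For n = 2 the algebra is gl(2), which is reductive by gl2_reductive.  For
    n > 2 the ideal K, which is abelian by its very definition, contains
    X^(n-2) e, and [h, X^(n-2) e] = 2 X^(n-2) e is not 0. *)

(** * Preliminaries on polynomials and two-by-two matrices *)

Lemma dvdp_XnP (F : fieldType) (n : nat) (p : {poly F}) :
  reflect (forall i, (i < n)%N -> p`_i = 0) ('X^n %| p).
Proof.
apply: (iffP (dvdpP _ _)) => [[q ->] i i_lt|p0]; first by rewrite coefMXn i_lt.
exists (drop_poly n p); rewrite -[LHS](poly_take_drop n) -[RHS]add0r.
congr (_ + _); apply/polyP=> i; rewrite coef_take_poly coef0.
by case: ifP => // /p0.
Qed.

Lemma ord2P (P : 'I_2 -> Prop) : P 0 -> P 1 -> forall i, P i.
Proof.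
move=> P0 P1 i; case: (unliftP 0 i) => [j ->|-> //].
by rewrite (_ : lift 0 j = 1) //; apply: val_inj; rewrite /= ord1.
Qed.

Lemma sum_ord2 (R : nmodType) (G : 'I_2 -> R) : \sum_i G i = G 0 + G 1.
Proof.
rewrite !big_ord_recl big_ord0 addr0.
by rewrite (_ : lift ord0 ord0 = 1) //; apply: val_inj.
Qed.

Lemma mulmx2 (R : pzSemiRingType) (m p : nat)
    (A : 'M[R]_(m, 2)) (B : 'M[R]_(2, p)) i j :
  (A *m B) i j = A i 0 * B 0 j + A i 1 * B 1 j.
Proof. by rewrite mxE sum_ord2. Qed.

Lemma mxtrace2 (R : pzSemiRingType) (A : 'M[R]_2) : \tr A = A 0 0 + A 1 1.
Proof. exact: sum_ord2. Qed.

Section Conjugation.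
Variable R : comNzRingType.
Implicit Types p q : {poly R}.

Definition conjp : {poly R} -> {poly R} := comp_poly (- 'X).

HB.instance Definition _ := GRing.RMorphism.on conjp.
HB.instance Definition _ := GRing.Linear.on conjp.

Lemma coef_conjp p i : (conjp p)`_i = (-1) ^+ i * p`_i.
Proof.
rewrite /conjp comp_polyE coef_sum -[in RHS](coefK p) poly_def.
rewrite coef_sum mulr_sumr.
apply: eq_bigr => j _.
have -> : - 'X = (-1)%:P * 'X :> {poly R} by rewrite polyCN mulN1r.
rewrite exprMn -polyC_exp !coefZ coefCM coefXn.
by case: eqP => [->|_]; rewrite ?mulr1 ?mulr0 // mulrC.
Qed.

Lemma conjpX : conjp 'X = - 'X. Proof. exact: comp_polyX. Qed.

Lemma conjpC c : conjp c%:P = c%:P. Proof. exact: comp_polyC. Qed.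

Lemma conjpK : involutive conjp.
Proof.
by move=> p; apply/polyP=> i; rewrite !coef_conjp mulrA -expr2 sqrr_sign mul1r.
Qed.

Lemma conjp_comp_X2 p : conjp (p \Po 'X^2) = p \Po 'X^2.
Proof. by rewrite /conjp -comp_polyA comp_Xn_poly sqrrN. Qed.

Lemma conjp_even_odd p :
  conjp p = (even_poly p \Po 'X^2) - (odd_poly p \Po 'X^2) * 'X.
Proof.
by rewrite -{1}(poly_even_odd p) rmorphD rmorphM /= !conjp_comp_X2 conjpX mulrN.
Qed.

(** As conjugation changes the sign of the odd coefficients, moving it across a
    product costs a sign there.  This turns the symmetric form f^+ into a
    skew-hermitian one. *)
Lemma coef_conjpM_odd p q i : odd i -> (p * conjp q)`_i = - (conjp p * q)`_i.
Proof.
move=> i_odd; rewrite -[p in LHS]conjpK -rmorphM coef_conjp.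
by rewrite -signr_odd i_odd mulN1r.
Qed.

End Conjugation.

(** * The form in polynomial coordinates *)

Section Gram.
Variables (F : fieldType) (n : nat) (V : vectType F) (f : {biscalar V}).
Variable e : (n + n).-tuple V.
Hypothesis n_gt0 : (0 < n)%N.
Hypothesis gram : forall i j, f (tnth e i) (tnth e j) = gram_A n 1 i j.
Implicit Types P Q p q r : {poly F}.

(** The second half of the basis is read backwards, so that the duality between
    the halves pairs X^i with X^(n-1-i) and becomes the coefficient of X^(n-1)
    in a product. *)
Definition gram_sum P Q : V :=
  \sum_(i < n) (P`_i *: tnth e (lshift n i)
                + Q`_i *: tnth e (rshift n (rev_ord i))).

Lemma gram_sum_linear a P Q P' Q' :
  gram_sum (a *: P + P') (a *: Q + Q') = a *: gram_sum P Q + gram_sum P' Q'.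
Proof.
rewrite /gram_sum scaler_sumr -big_split /=; apply: eq_bigr => i _.
by rewrite !coefD !coefZ !scalerDl scalerDr !scalerA addrACA.
Qed.

Lemma gram_sum_eq P Q P' Q' :
    (forall i, (i < n)%N -> P`_i = P'`_i /\ Q`_i = Q'`_i) ->
  gram_sum P Q = gram_sum P' Q'.
Proof.
by move=> eqPQ; apply: eq_bigr => i _; have [-> ->] := eqPQ i (ltn_ord i).
Qed.

(** The lower triangular Jordan block is multiplication by 1 + X in these
    coordinates. *)
Lemma form_gram_sum P Q P' Q' :
  f (gram_sum P Q) (gram_sum P' Q') = (P * Q' + (1 + 'X) * (Q * P'))`_n.-1.
Proof.
have fll i j : f (tnth e (lshift n i)) (tnth e (lshift n j)) = 0.
  by rewrite gram /gram_A block_mxEul mxE.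
have flr i j : f (tnth e (lshift n i)) (tnth e (rshift n j)) = (i == j)%:R.
  by rewrite gram /gram_A block_mxEur mxE.
have frl i j : f (tnth e (rshift n i)) (tnth e (lshift n j))
    = (i == j)%:R + (i == j.+1 :> nat)%:R.
  by rewrite gram /gram_A block_mxEdl mxE.
have frr i j : f (tnth e (rshift n i)) (tnth e (rshift n j)) = 0.
  by rewrite gram /gram_A block_mxEdr mxE.
have sum_pick (c : {poly F}) m :
    (m < n)%N -> \sum_(j < n) c`_j * (m == j)%:R = c`_m :> F.
  move=> m_lt; rewrite (bigD1 (Ordinal m_lt)) //= eqxx mulr1.
  rewrite big1 ?addr0 // => j.
  by rewrite -val_eqE /= eq_sym => /negPf->; rewrite mulr0.
have sum_pickS (c : {poly F}) m :
    (m < n)%N -> \sum_(j < n) c`_j * (m == j.+1)%:R = ('X * c)`_m.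
  rewrite coefXM; case: m => [|m] m_lt /=.
    by rewrite big1 // => j _; rewrite mulr0.
  by rewrite -(sum_pick c _ (ltnW m_lt)); apply: eq_bigr.
have coefMn p q : (p * q)`_n.-1 = \sum_(i < n) p`_i * q`_(rev_ord i).
  rewrite coefM prednK //; apply: eq_bigr => i _ /=; congr (_ * _`_ _); lia.
have innerE (i : 'I_n) :
    f (P`_i *: tnth e (lshift n i) + Q`_i *: tnth e (rshift n (rev_ord i)))
      (gram_sum P' Q')
    = P`_i * Q'`_(rev_ord i) + Q`_i * ((1 + 'X) * P')`_(rev_ord i).
  rewrite mulrDl mul1r coefD -sum_pickS ?ltn_ord // -!sum_pick ?ltn_ord //.
  rewrite -big_split !mulr_sumr -big_split linear_sumr /=.
  apply: eq_bigr => j _.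
  rewrite linearDl !linearDr /= !linearZl_LR !linearZr_LR /=.
  rewrite fll frr flr frl !mulr0 addr0 add0r /= eq_sym (inv_eq rev_ordK) eq_sym.
  by rewrite -val_eqE /=; ring.
rewrite /gram_sum linear_sumlz (eq_bigr _ (fun i _ => innerE i)) big_split /=.
by rewrite mulrCA coefD !coefMn.
Qed.

End Gram.

(** * The coordinate X / (2 + X) *)

Section Cayley.
Variables (F : fieldType) (n : nat).
Hypothesis two_neq0 : 2%:R != 0 :> F.
Implicit Types p q r : {poly F}.

Definition twoX : {poly F} := 2%:R + 'X.

(** The inverse of 2 + X modulo X^n, as a truncated geometric series. *)
Definition inv_twoX : {poly F} :=
  (2%:R^-1)%:P * \sum_(i < n) (- (2%:R^-1)%:P * 'X) ^+ i.

Lemma coefM_inv_twoX p m i :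
  (i < n)%N -> (p * (inv_twoX * twoX) ^+ m)`_i = p`_i.
Proof.
have gE : inv_twoX * twoX = 1 - (- (2%:R^-1)%:P) ^+ n * 'X ^+ n.
  rewrite -exprMn -opprB subrX1 /inv_twoX /twoX.
  have half2 : (2%:R^-1)%:P * 2%:R = 1 :> {poly F}.
    by rewrite -polyC_natr -polyCM mulVf.
  rewrite -mulNr; set S := \sum_(i < n) _.
  by rewrite mulrAC mulrDr half2; congr (_ * _); ring.
move=> i_lt; elim: m p => [|m IHm] p; first by rewrite mulr1.
rewrite exprS mulrA IHm gE mulrBr mulr1 mulrA coefB coefMXn i_lt.
by rewrite subr0.
Qed.

(** This is X / (2 + X) modulo X^n, by which sigma^{+-} acts, up to sign, on
    the polynomial coordinates: it is (1 - t) / (1 + t), the Cayley transform,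
    of the value t = (1 + X)^-1 of the asymmetry of f. *)
Definition cayley : {poly F} := inv_twoX * 'X.

Hypothesis n_gt1 : (1 < n)%N.

(** This is - 2 (2 + X)^(n-3) modulo X^n; the exponent is negative for n = 2. *)
Definition residue_weight : {poly F} := - (2%:R * (twoX ^+ (n - 2) * inv_twoX)).

(** Lagrange inversion: with Y = X / (2 + X), one has dY = 2 dX / (2 + X)^2, so
    the residue of r(Y) dY / Y^n is that of 2 (2 + X)^(n-2) r(Y) dX / X^n.  The
    case r = 'X^m is elementary: for m < n - 1 the expression is
    - 2 X^m (2 + X)^(n-2-m), of degree n - 2. *)
Lemma coef_residue r :
  (twoX * residue_weight * (r \Po cayley))`_n.-1 = - r`_n.-1.
Proof.
have half2 : inv_twoX.[0] * 2%:R = 1.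
  have := coefM_inv_twoX 1 1 (ltnW n_gt1).
  by rewrite mul1r expr1 -!horner_coef0 /twoX !hornerE.
have twoX_big k : (twoX ^+ k)`_k.+1 = 0.
  rewrite nth_default // (leq_trans (size_poly_exp_leq _ _)) //.
  by rewrite /twoX -polyC_natr addrC size_XaddC mul1n.
have monomial m :
    (twoX * residue_weight * cayley ^+ m)`_n.-1 = - (n.-1 == m)%:R.
  rewrite /residue_weight /cayley exprMn.
  have [m_big|m_small] := leqP n.-1 m.
    have -> : twoX * - (2%:R * (twoX ^+ (n - 2) * inv_twoX))
          * (inv_twoX ^+ m * 'X^m)
        = - (2%:R * twoX ^+ (n - 2) * inv_twoX ^+ m
             * (inv_twoX * twoX) ^+ 1 * 'X^m).
      by rewrite expr1; ring.
    rewrite coefN coefMXn; case: ltngtP m_big => // m_eq _.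
    rewrite m_eq subnn coefM_inv_twoX ?(ltnW n_gt1) // -horner_coef0.
    move: inv_twoX half2 => c c2; rewrite /twoX !hornerE -m_eq.
    rewrite -{2}(subnK n_gt1) addn2 /=.
    by rewrite mulrC -exprS -exprMn c2 expr1n.
  have -> : twoX * - (2%:R * (twoX ^+ (n - 2) * inv_twoX))
        * (inv_twoX ^+ m * 'X^m)
      = - (2%:R * (twoX ^+ (n - 2 - m) * (inv_twoX * twoX) ^+ m.+1 * 'X^m)).
    rewrite [(_ * twoX) ^+ _]exprMn !exprS.
    have -> : twoX ^+ (n - 2) = twoX ^+ (n - 2 - m) * twoX ^+ m.
      by rewrite -exprD; congr (_ ^+ _); lia.
    ring.
  rewrite coefN mulr_natl coefMn coefMXn ltnNge ltnW //=.
  rewrite coefM_inv_twoX; last by lia.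
  rewrite (_ : (n.-1 - m)%N = (n - 2 - m).+1); last by lia.
  by rewrite twoX_big mul0rn (gtn_eqF m_small).
rewrite comp_polyE mulr_sumr coef_sum -[in RHS](coefK r) poly_def coef_sum.
rewrite -sumrN; apply: eq_bigr => m _.
by rewrite -scalerAr !coefZ monomial coefXn mulrN.
Qed.

End Cayley.

(** * The skew-hermitian model *)

Section Model.
Variables (F : fieldType) (n : nat) (V : vectType F) (f : {biscalar V}).
Implicit Types w : 'cV[{poly F}]_2.

Definition herm w w' : {poly F} :=
  conjp (w 0 0) * w' 1 0 - conjp (w 1 0) * w' 0 0.

(** The polynomial columns stand for their classes modulo X^n.  That chart is
    onto and has no further kernel follows from these properties when V has
    dimension 2n; see chart_surj and chart_eq0. *)
Record polynomial_model (chart : 'cV[{poly F}]_2 -> V) : Prop :=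
  PolynomialModel {
  chart_linear : forall a w w',
    chart (a%:P *: w + w') = a *: chart w + chart w';
  chart_Xn : forall w, chart ('X^n *: w) = 0;
  fplus_chart : forall w w', fplus f (chart w) (chart w') = (herm w w')`_n.-1;
  fminus_chart : forall w w',
    fminus f (chart w) (chart w') = (herm w ('X *: w'))`_n.-1 }.

Variable e : (n + n).-tuple V.
Hypothesis two_neq0 : 2%:R != 0 :> F.
Hypothesis n_gt1 : (1 < n)%N.
Hypothesis n_even : ~~ odd n.
Hypothesis gram : forall i j, f (tnth e i) (tnth e j) = gram_A n 1 i j.

(** Since sigma^{+-} acts as - X / (2 + X) on the second half of the basis and
    as + X / (2 + X) on the first, only the second coordinate is conjugated;
    the weight makes the pairing of the halves the one of herm. *)
Definition gram_chart w : V :=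
  gram_sum e (w 0 0 \Po cayley F n)
             (residue_weight F n * (conjp (w 1 0) \Po cayley F n)).

(** In the coordinates P, Q of gram_sum, f^+ is the coefficient of X^(n-1) in
    (2 + X)(P Q' + Q P') and f^- that in - X (P Q' - Q P'); since
    X = (2 + X) Y, where Y is cayley, both are given by coef_residue. *)
Lemma gram_chart_model : polynomial_model gram_chart.
Proof.
have n_gt0 := ltnW n_gt1.
have eq_coef (p q : {poly F}) : p = q -> p`_n.-1 = q`_n.-1 by move->.
have odd_n1 : odd n.-1 by rewrite -[odd _]negbK -oddS prednK.
have form_chart w w' : f (gram_chart w) (gram_chart w') =
    (residue_weight F n * (w 0 0 * conjp (w' 1 0) \Po cayley F n)
     + (1 + 'X) * (residue_weight F n
                   * (conjp (w 1 0) * w' 0 0 \Po cayley F n)))`_n.-1.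
  rewrite form_gram_sum // !rmorphM /=; apply: eq_coef; ring.
have residueE r :
    (residue_weight F n * twoX F * (r \Po cayley F n))`_n.-1 = - r`_n.-1.
  by rewrite -coef_residue // [twoX F * _]mulrC.
have herm_swap w w' :
    - (w 0 0 * conjp (w' 1 0) + conjp (w 1 0) * w' 0 0 : {poly F})`_n.-1
    = (herm w w')`_n.-1.
  by rewrite coefD coef_conjpM_odd // coefB opprD opprK.
split=> [a w w'|w|w w'|w w'].
- rewrite /gram_chart -gram_sum_linear !mxE !rmorphD !rmorphM /=.
  rewrite conjpC !comp_polyC.
  by rewrite !mul_polyC mulrDr scalerAr.
- rewrite (_ : 0 = gram_sum e 0 0); last first.
    by rewrite /gram_sum big1 // => i _; rewrite !coef0 !scale0r addr0.
  have Xn_comp p i : (i < n)%N -> (p * ('X ^+ n \Po cayley F n))`_i = 0.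
    move=> i_lt; rewrite rmorphXn /= comp_polyX /cayley.
    by rewrite [(_ * 'X) ^+ _]exprMn mulrA coefMXn i_lt.
  apply: gram_sum_eq => i i_lt; rewrite !mxE !rmorphM /= !coef0.
  have -> : conjp 'X^n = 'X^n :> {poly F}.
    by rewrite rmorphXn /= conjpX exprNn -signr_odd (negPf n_even) mul1r.
  by rewrite mulrCA ![('X^n \Po _) * _]mulrC !Xn_comp.
- rewrite -herm_swap -residueE /fplus !form_chart -coefD; apply: eq_coef.
  rewrite !rmorphD !rmorphM /= /twoX; ring.
- rewrite -herm_swap -residueE /fminus !form_chart -coefB.
  have -> : w 0 0 * conjp (('X *: w') 1 0) + conjp (w 1 0) * ('X *: w') 0 0
      = 'X * (conjp (w 1 0) * w' 0 0 - w 0 0 * conjp (w' 1 0)).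
    by rewrite !mxE rmorphM /= conjpX; ring.
  rewrite [('X * _) \Po _]comp_polyM comp_polyX comp_polyB /cayley.
  set u := residue_weight F n.
  rewrite -[LHS](@coefM_inv_twoX F n two_neq0 _ 1) ?prednK // expr1.
  apply: eq_coef; rewrite [conjp _ * w 0 0]mulrC [w' 0 0 * _]mulrC.
  ring.
Qed.

End Model.

(** * Reductivity of gl(2) *)

Section Gl2Reductive.
Variables (F : fieldType) (L : lieAlgType F) (z h e g : L).
Hypothesis two_neq0 : 2%:R != 0 :> F.
Hypotheses (z_central : forall x, [Lie z, x] = 0) (h_neq0 : h != 0).
Hypotheses (he : [Lie h, e] = 2%:R *: e) (hg : [Lie h, g] = - 2%:R *: g).
Hypothesis eg : [Lie e, g] = h.
Hypothesis spanL :
  forall y : L, exists a b c d, y = a *: h + b *: z + c *: e + d *: g.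
Implicit Type I : {vspace L}.

Lemma mem_lie_prod (U W : {vspace L}) u w :
  u \in U -> w \in W -> [Lie u, w] \in lie_prod U W.
Proof. exact: (lie_prodP _ _ _ (subvv _)). Qed.

Let bracketN x y : [Lie x, - y] = - [Lie x, y] :> L.
Proof. by rewrite -scaleN1r bracketZr scaleN1r. Qed.

Let memZ2 I y : (2%:R *: y \in I) = (y \in I).
Proof.
apply/idP/idP => [/(rpredZ (2%:R^-1 : F))|]; last exact: rpredZ.
by rewrite scalerA mulVf ?scale1r.
Qed.

Let eh : [Lie e, h] = - (2%:R *: e). Proof. by rewrite bracketC he. Qed.
Let gh : [Lie g, h] = 2%:R *: g.
Proof. by rewrite bracketC hg scaleNr opprK. Qed.

Lemma sl2_derived_series I k :
    [/\ h \in I, e \in I & g \in I] ->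
  [/\ h \in derived_series I k, e \in derived_series I k
    & g \in derived_series I k].
Proof.
move=> [hI eI gI]; elim: k => [//|k [hD eD gD]]; split=> /=.
- by rewrite -eg mem_lie_prod.
- by rewrite -memZ2 -he mem_lie_prod.
- by rewrite -memZ2 -gh mem_lie_prod.
Qed.

(** An ideal that contains one of h, e, g contains all three, and they then
    survive in its whole derived series. *)
Lemma solvable_ideal_notin I : lie_ideal I -> lie_solvable I ->
  [/\ h \notin I, e \notin I & g \notin I].
Proof.
move=> idI [k solI].
have hI : h \notin I.
  apply/negP => hI; have eI : e \in I by rewrite -memZ2 -rpredN -eh idI.
  have gI : g \in I by rewrite -memZ2 -gh idI.
  have [hD _ _] := sl2_derived_series k (And3 hI eI gI).
  by move: hD; rewrite solI memv0 (negPf h_neq0).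
split=> //.
  by apply: contra hI => eI; rewrite -eg bracketC rpredN idI.
by apply: contra hI => gI; rewrite -eg idI.
Qed.

(** If a h + b z + c e + d g lies in a solvable ideal, then applying ad e twice
    gives - 2 d e, hence d = 0, and applying ad g twice gives - 2 c g, hence
    c = 0; then ad e gives - 2 a e, so that only the central b z is left. *)
Lemma gl2_reductive : reductive L.
Proof.
move=> I idI solI; have [hI eI gI] := solvable_ideal_notin idI solI.
have zr x : [Lie x, z] = 0 by rewrite bracketC z_central oppr0.
have memZ a y : y \notin I -> a *: y \in I -> a = 0.
  move=> yI ayI; apply/eqP; apply: contraNT yI => a0.
  by rewrite -[y](scalerK a0) rpredZ.
move=> x y; have [a [b [c [d ->]]]] := spanL x => xI.
have adE u : [Lie u, a *: h + b *: z + c *: e + d *: g]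
    = a *: [Lie u, h] + c *: [Lie u, e] + d *: [Lie u, g].
  by rewrite !bracketDr !bracketZr zr scaler0 addr0.
have adeI := idI e _ xI; have adgI := idI g _ xI.
have d0 : d = 0.
  apply: (memZ d e) => //; rewrite -memZ2.
  have := idI e _ adeI; rewrite adE eg bracketxx eh scaler0 addr0 bracketDr.
  rewrite !bracketZr bracketN bracketZr bracketxx !scaler0 oppr0 scaler0.
  by rewrite add0r eh scalerN scalerA mulrC -scalerA rpredN.
have c0 : c = 0.
  apply: (memZ c g) => //; rewrite -memZ2.
  have := idI g _ adgI.
  rewrite adE [ [Lie g, e] ]bracketC eg bracketxx gh scaler0 addr0.
  rewrite bracketDr !bracketZr bracketN bracketxx !scaler0 add0r.
  by rewrite gh scalerN scalerA mulrC -scalerA rpredN.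
have a0 : a = 0.
  apply: (memZ a e) => //; rewrite -memZ2.
  move: adeI; rewrite adE c0 d0 !scale0r !addr0 eh scalerN rpredN.
  by rewrite scalerA mulrC -scalerA.
by rewrite a0 c0 d0 !scale0r !addr0 add0r bracketZl z_central scaler0.
Qed.

End Gl2Reductive.

(** * The current algebra of gl(2) as polynomial matrices *)

Section CurrentMatrices.
Variable F : fieldType.
Implicit Types (M N : 'M[F]_2) (p q r s : {poly F}).

(** The traceless part of M plus (tr M / 2) X: replacing the scalar part c by
    c X is the same as adding c (X - 1). *)
Definition gl2_lift (M : 'M[F]_2) : 'M[{poly F}]_2 :=
  map_mx polyC M + ((2%:R^-1 * \tr M)%:P * ('X - 1))%:M.

Definition current_mx M p : 'M[{poly F}]_2 := (p \Po 'X^2) *: gl2_lift M.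

Lemma gl2_lift_linear a M N :
  gl2_lift (a *: M + N) = a%:P *: gl2_lift M + gl2_lift N.
Proof.
apply/matrixP=> i j; rewrite !mxE linearP /=.
have -> : 2%:R^-1 * (a * \tr M + \tr N)
    = a * (2%:R^-1 * \tr M) + 2%:R^-1 * \tr N.
  by rewrite mulrDr mulrCA.
by rewrite !(polyCD, polyCM); case: eqP => _; rewrite ?mulr1n ?mulr0n; ring.
Qed.

Lemma current_mx_linearl p a M N :
  current_mx (a *: M + N) p = a%:P *: current_mx M p + current_mx N p.
Proof. by rewrite /current_mx gl2_lift_linear scalerDr !scalerA mulrC. Qed.

Lemma current_mx_linearr M a p q :
  current_mx M (a *: p + q) = a%:P *: current_mx M p + current_mx M q.
Proof.
by rewrite /current_mx linearP /= scalerDl scalerA -mul_polyC.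
Qed.

(** Both lifts differ from the constant matrices by scalar matrices. *)
Lemma gl2_lift_bracket M N :
  gl2_lift M *m gl2_lift N - gl2_lift N *m gl2_lift M = map_mx polyC [Lie M, N].
Proof.
rewrite /gl2_lift; set z := (_ * (_ - 1)); set z' := (_ * (_ - 1)).
rewrite !mulmxDl !mulmxDr !mul_scalar_mx !mul_mx_scalar !scale_scalar_mx.
rewrite [z' * z]mulrC.
rewrite [in RHS]/bracket /= /mx_commutator map_mxB !map_mxM.
move: (_ *m _) (_ *m _) => MN NM; apply/matrixP=> i j; rewrite !mxE; ring.
Qed.

Lemma gl2_lift_tr0 M : \tr M = 0 -> gl2_lift M = map_mx polyC M.
Proof. by move=> tr0; rewrite /gl2_lift tr0 mulr0 mul0r raddf0 addr0. Qed.

Lemma tr_bracket M N : \tr [Lie M, N] = 0.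
Proof. by rewrite [LHS]linearB /= mxtrace_mulC subrr. Qed.

Definition sl2_h : 'M[F]_2 := delta_mx 0 0 - delta_mx 1 1.

Lemma mxtrace_sl2_h : \tr sl2_h = 0.
Proof. by rewrite mxtrace2 !mxE /=; ring. Qed.

Lemma mxtrace_delta (i j : 'I_2) : i != j -> \tr (delta_mx i j : 'M[F]_2) = 0.
Proof.
by move: i j; elim/ord2P; elim/ord2P; rewrite ?eqxx // mxtrace2 !mxE /= addr0.
Qed.

Lemma gl2_brackets :
  [/\ [Lie sl2_h, delta_mx 0 1 : 'M_2] = 2%:R *: delta_mx 0 1,
      [Lie sl2_h, delta_mx 1 0 : 'M_2] = - 2%:R *: delta_mx 1 0
    & [Lie delta_mx 0 1 : 'M_2, delta_mx 1 0] = sl2_h].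
Proof.
rewrite /bracket /= /mx_commutator.
by split; apply/matrixP; elim/ord2P; elim/ord2P;
   rewrite !(mulmx2, mxE) /=; ring.
Qed.

Hypothesis two_neq0 : 2%:R != 0 :> F.

Definition comb_mx p q r s : 'M[{poly F}]_2 :=
  current_mx sl2_h p + current_mx 1%:M q + current_mx (delta_mx 0 1) r
  + current_mx (delta_mx 1 0) s.

Lemma comb_mxE p q r s :
  [/\ comb_mx p q r s 0 0 = (p \Po 'X^2) + (q \Po 'X^2) * 'X,
      comb_mx p q r s 1 1 = - (p \Po 'X^2) + (q \Po 'X^2) * 'X,
      comb_mx p q r s 0 1 = r \Po 'X^2 & comb_mx p q r s 1 0 = s \Po 'X^2].
Proof.
have lift1 : gl2_lift 1%:M = 'X%:M.
  rewrite /gl2_lift map_scalar_mx mxtrace1 mulVf // mul1r -raddfD /=.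
  by rewrite addrC subrK.
rewrite /comb_mx /current_mx lift1 !gl2_lift_tr0 ?mxtrace_delta //;
  last exact: mxtrace_sl2_h.
rewrite !mxE /= !(mulr0n, mulr1n, mulr0, mulr1, addr0, add0r, subr0, sub0r).
by split; rewrite ?polyCN ?oppr0 ?mulrN ?mulr1 ?mulr0 ?oppr0 ?add0r.
Qed.

Variable k : nat.
Hypothesis k_gt0 : (0 < k)%N.
Local Notation A := {poly %/ ('X^k : {poly F})}.
Implicit Types a b c d : A.

Lemma size_mk_monic_Xk : (size (mk_monic ('X^k : {poly F}))).-1 = k.
Proof. by rewrite mk_monic_Xn size_polyXn prednK. Qed.

Lemma in_qpoly_comp p :
  'X^(k.*2) %| (p \Po 'X^2) - ((in_qpoly 'X^k p : {poly F}) \Po 'X^2).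
Proof.
rewrite -rmorphB /= -[Pdiv.CommonRing.rmodp _ _]/(Pdiv.Ring.rmodp _ _).
rewrite -Pdiv.IdomainMonic.modpE ?monic_mk_monic //.
rewrite {1}(divp_eq p (mk_monic 'X^k)) addrK mk_monic_Xn prednK //.
by rewrite rmorphM rmorphXn /= comp_polyX -exprM mul2n dvdp_mull.
Qed.

Lemma qpoly_eq0 a : (forall i, (i < k)%N -> a`_i = 0) -> a = 0.
Proof.
move=> a0; apply/val_inj/polyP=> i; rewrite coef0.
by have [/a0 //|i_ge] := ltnP i k; rewrite big_coef_npoly ?size_mk_monic_Xk.
Qed.

Lemma qpoly_comp_eq0 a : 'X^(k.*2) %| (a : {poly F}) \Po 'X^2 -> a = 0.
Proof.
move=> /dvdp_XnP dvd_a; apply: qpoly_eq0 => i i_lt; have := dvd_a i.*2.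
rewrite ltn_double i_lt coef_comp_poly_Xn // -muln2.
by rewrite dvdn_mull // mulnK // => ->.
Qed.

Lemma qpoly_compX_eq0 a :
  'X^(k.*2) %| ((a : {poly F}) \Po 'X^2) * 'X -> a = 0.
Proof.
move=> /dvdp_XnP dvd_a; apply: qpoly_eq0 => i i_lt; have := dvd_a i.*2.+1.
rewrite ltn_Sdouble i_lt coefMX /= coef_comp_poly_Xn // -muln2.
by rewrite dvdn_mull // mulnK // => ->.
Qed.

Definition gl2_comb a b c d : current 'M[F]_2 k :=
  tens sl2_h a + tens 1%:M b + tens (delta_mx 0 1) c + tens (delta_mx 1 0) d.

Lemma gl2_combE t : exists a b c d, t = gl2_comb a b c d.
Proof.
elim/tensor_ind: t => [M p|s t [a [b [c [d ->]]]] [a' [b' [c' [d' ->]]]]].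
  exists ((2%:R^-1 * (M 0 0 - M 1 1)) *: p).
  exists ((2%:R^-1 * (M 0 0 + M 1 1)) *: p).
  exists (M 0 1 *: p), (M 1 0 *: p).
  rewrite /gl2_comb !linearZr_LR /= -!linearZl_LR -!linearDl; congr (tens _ p).
  apply/matrixP; elim/ord2P; elim/ord2P; rewrite !mxE /=
    ?(mulr0, mulr1, addr0, add0r, subr0, sub0r, mulr0n, mulr1n, oppr0) //.
  - by field.
  - by field.
exists (a + a'), (b + b'), (c + c'), (d + d'); rewrite /gl2_comb !linearDr /=.
by rewrite [LHS]addrACA; congr (_ + _); rewrite [LHS]addrACA; congr (_ + _);
   rewrite addrACA.
Qed.

Lemma dim_current_gl2 : dim (current 'M[F]_2 k) = (2 * 2 * k)%N.
Proof.
rewrite [LHS]/dim /=.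
by rewrite -[dim {poly %/ _}]/(size (mk_monic ('X^k : {poly F}))).-1
           size_mk_monic_Xk.
Qed.

End CurrentMatrices.

Section Structure.
Variables (F : fieldType) (n : nat) (V : vectType F) (f : {biscalar V}).
Variable chart : 'cV[{poly F}]_2 -> V.
Hypothesis two_neq0 : 2%:R != 0 :> F.
Hypothesis n_gt1 : (1 < n)%N.
Hypothesis n_even : ~~ odd n.
Hypothesis dimV : \dim {:V} = (n + n)%N.
Hypothesis model : polynomial_model n f chart.
Implicit Types (v : V) (x y : 'End(V)) (p q : {poly F}) (w : 'cV[{poly F}]_2).
Implicit Types U : 'M[{poly F}]_2.

(** * The chart identifies V with a free module of rank two *)

Lemma chartD w w' : chart (w + w') = chart w + chart w'.
Proof. by have := chart_linear model 1 w w'; rewrite !scale1r. Qed.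

Lemma chart0 : chart 0 = 0.
Proof. by apply: (addrI (chart 0)); rewrite -chartD !addr0. Qed.

Lemma chartZ a w : chart (a%:P *: w) = a *: chart w.
Proof. by have := chart_linear model a w 0; rewrite chart0 !addr0. Qed.

Lemma chartB w w' : chart (w - w') = chart w - chart w'.
Proof.
by rewrite addrC -scaleN1r -polyCN (chart_linear model) scaleN1r addrC.
Qed.

Lemma fplus_chart_eq0 w :
  (forall u, fplus f (chart w) u = 0) -> forall i, 'X^n %| w i 0.
Proof.
move=> w0; have n_gt0 := ltnW n_gt1.
(* The multiple by X^(n-1-i) moves the coefficient of index i to n - 1. *)
have conj_dvd p : (forall j, (conjp p * 'X^j)`_n.-1 = 0) -> 'X^n %| p.
  move=> p0; apply/dvdp_XnP => i i_lt; have := p0 (n.-1 - i)%N.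
  rewrite coefMXn ltnNge leq_subr /= subKn; last by rewrite -ltnS prednK.
  by rewrite coef_conjp => /eqP; rewrite mulf_eq0 signr_eq0 => /eqP.
apply: ord2P; apply: conj_dvd => j.
  have := fplus_chart model w (\col_i (if i == 0 then 0 else 'X^j)).
  by rewrite w0 /herm !mxE /= mulr0 subr0.
have := fplus_chart model w (\col_i (if i == 0 then - 'X^j else 0)).
by rewrite w0 /herm !mxE /= mulr0 add0r mulrN opprK.
Qed.

Lemma chart_eq0 w : chart w = 0 <-> forall i, 'X^n %| w i 0.
Proof.
split=> [w0|dvd_w].
  by apply: fplus_chart_eq0 => u; rewrite w0 /fplus linear0l linear0r addr0.
rewrite -[RHS](chart_Xn model (map_mx (fun p => p %/ 'X^n) w)); congr chart.
by apply/matrixP=> i j; rewrite !mxE ord1 mulrC divpK.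
Qed.

Lemma chart_eq w w' : chart w = chart w' <-> forall i, 'X^n %| w i 0 - w' i 0.
Proof.
have -> : chart w = chart w' <-> chart (w - w') = 0.
  by rewrite chartB; split=> [->|/eqP]; rewrite ?subrr ?subr_eq0 // => /eqP.
by rewrite chart_eq0; split=> dvd_w i; have := dvd_w i; rewrite !mxE.
Qed.

Definition small_col (M : 'M[F]_(2, n)) : 'cV[{poly F}]_2 :=
  \col_i rVpoly (row i M).

Definition small_chart M := chart (small_col M).

Lemma small_chart_linear : linear small_chart.
Proof.
move=> a M N; rewrite /small_chart -(chart_linear model); congr chart.
by apply/colP=> i; rewrite !mxE !linearP mul_polyC.
Qed.
HB.instance Definition _ :=
  GRing.isLinear.Build F 'M[F]_(2, n) V _ small_chart small_chart_linear.

(** The columns of polynomials of degree less than n form a space of dimension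
    2n, on which the chart is injective. *)
Lemma chart_surj v : exists w, chart w == v.
Proof.
have ker0 : (lker (linfun small_chart) == 0)%VS.
  apply/lker0P=> M N; rewrite !lfunE => /= eqMN; apply/row_matrixP=> i.
  apply: (can_inj rVpolyK); have /chart_eq/(_ i) := eqMN.
  rewrite !mxE -linearB /= => /dvdp_XnP dvd_i; apply/eqP; rewrite -subr_eq0.
  rewrite -linearB; apply/eqP/polyP=> j; rewrite coef0.
  have [/dvd_i //|j_ge] := ltnP j n.
  by rewrite nth_default // (leq_trans (size_poly _ _)).
have : v \in limg (linfun small_chart).
  suff -> : limg (linfun small_chart) = fullv by exact: memvf.
  apply/eqP; rewrite eqEdim subvf limg_dim_eq ?(eqP ker0) ?capv0 //.
  rewrite dimV dimvf (_ : dim _ = 2 * n)%N ?dim_matrix //.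
  by rewrite mul2n addnn leqnn.
by case/memv_imgP=> M _ ->; exists (small_col M); rewrite lfunE.
Qed.

Lemma chartW (P : V -> Prop) : (forall w, P (chart w)) -> forall v, P v.
Proof. by move=> Pw v; have [w /eqP<-] := chart_surj v. Qed.

Lemma fplusC u v : fplus f u v = fplus f v u.
Proof. by rewrite /fplus addrC. Qed.

Lemma fplus_nondeg v : (forall u, fplus f u v = 0) -> v = 0.
Proof.
have [w /eqP<-] := chart_surj v => w0; apply/chart_eq0/fplus_chart_eq0 => u.
by rewrite fplusC.
Qed.

(** * Operators given by polynomial matrices *)

Lemma chart_mul U w w' : chart w = chart w' -> chart (U *m w) = chart (U *m w').
Proof.
move=> /chart_eq eqw; apply/chart_eq => i; rewrite !mxE -sumrB.
apply: (big_ind (dvdp 'X^n)) => [|p q|j _]; [exact: dvdp0 | exact: dvdp_add |].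
by rewrite -mulrBr dvdp_mull.
Qed.

(** The choice of a representative does not matter, by chart_mul. *)
Definition chart_lift v := xchoose (chart_surj v).

Lemma chart_liftK v : chart (chart_lift v) = v.
Proof. exact/eqP/(xchooseP (chart_surj v)). Qed.

Definition mx_fun U v := chart (U *m chart_lift v).

Lemma mx_funE U w : mx_fun U (chart w) = chart (U *m w).
Proof. by apply: chart_mul; rewrite chart_liftK. Qed.

Lemma mx_fun_linear U : linear (mx_fun U).
Proof.
move=> a; apply: chartW => w; apply: chartW => w'.
rewrite -(chart_linear model) !mx_funE mulmxDr -scalemxAr.
exact: (chart_linear model).
Qed.
HB.instance Definition _ U :=
  GRing.isLinear.Build F V V _ (mx_fun U) (mx_fun_linear U).

Definition mx_end U : 'End(V) := linfun (mx_fun U).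

Lemma mx_endE U w : mx_end U (chart w) = chart (U *m w).
Proof. by rewrite lfunE /= mx_funE. Qed.

Lemma eq_endP x y : (forall w, x (chart w) = y (chart w)) -> x = y.
Proof. by move=> eqxy; apply/lfunP; apply: chartW. Qed.

Lemma mx_endM U U' : mx_end (U *m U') = (mx_end U \o mx_end U')%VF.
Proof. by apply: eq_endP => w; rewrite comp_lfunE !mx_endE mulmxA. Qed.

Lemma mx_end_linear a U U' :
  mx_end (a%:P *: U + U') = a *: mx_end U + mx_end U'.
Proof.
apply: eq_endP => w; rewrite add_lfunE scale_lfunE !mx_endE mulmxDl -scalemxAl.
exact: (chart_linear model).
Qed.

Lemma mx_endB U U' : mx_end (U - U') = mx_end U - mx_end U'.
Proof.
apply: eq_endP => w; rewrite add_lfunE opp_lfunE !mx_endE mulmxBl.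
exact: chartB.
Qed.

Lemma mx_end_eq0 U : mx_end U = 0 <-> forall i j, 'X^n %| U i j.
Proof.
split=> [U0 i j|dvdU].
  have := mx_endE U (delta_mx j 0).
  rewrite U0 zero_lfunE => /esym/chart_eq0/(_ i).
  by rewrite -colE mxE.
apply: eq_endP => w; rewrite zero_lfunE mx_endE; apply/chart_eq0 => i.
rewrite mxE; apply: (big_ind (dvdp 'X^n)) => [|p q|j _];
  [exact: dvdp0 | exact: dvdp_add |].
exact: dvdp_mulr.
Qed.

Lemma mx_end_eq U U' :
  mx_end U = mx_end U' <-> forall i j, 'X^n %| U i j - U' i j.
Proof.
have -> : mx_end U = mx_end U' <-> mx_end (U - U') = 0.
  by rewrite mx_endB; split=> [->|/eqP]; rewrite ?subrr ?subr_eq0 // => /eqP.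
by rewrite mx_end_eq0; split=> dvdU i j; have := dvdU i j; rewrite !mxE.
Qed.

Lemma bracket_mx_end U U' :
  [Lie mx_end U, mx_end U'] = mx_end (U *m U' - U' *m U).
Proof. by rewrite mx_endB !mx_endM. Qed.

Definition sigma : 'End(V) := mx_end 'X%:M.

Lemma sigmaE w : sigma (chart w) = chart ('X *: w).
Proof. by rewrite mx_endE mul_scalar_mx. Qed.

Lemma sigmaP : unique (is_sigma f) sigma.
Proof.
have sigmaE u v : fminus f u v = fplus f u (sigma v).
  have [w /eqP<-] := chart_surj u; have [w' /eqP<-] := chart_surj v.
  by rewrite (fminus_chart model) sigmaE (fplus_chart model).
split=> // s sP; apply/lfunP=> v; apply/eqP; rewrite -subr_eq0; apply/eqP.
apply: fplus_nondeg => u; have := sP u v; rewrite sigmaE => eqs.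
rewrite /fplus linearBl linearBr /= addrACA -opprD -/(fplus f _ _) eqs.
exact: subrr.
Qed.

(** * L(f) as a space of polynomial matrices *)

Lemma skew_fplus x : x \in skew_space f ->
  forall u v, fplus f (x u) v = - fplus f u (x v).
Proof.
by move=> /skew_spaceP skx u v; rewrite /fplus !skx opprD opprK.
Qed.

Lemma skew_fminus x : x \in skew_space f ->
  forall u v, fminus f (x u) v = - fminus f u (x v).
Proof.
by move=> /skew_spaceP skx u v; rewrite /fminus !skx opprD opprK.
Qed.

Lemma skew_spaceE x :
    (forall u v, fplus f (x u) v = - fplus f u (x v)) ->
    (forall u v, fminus f (x u) v = - fminus f u (x v)) ->
  x \in skew_space f.
Proof.
move=> skp skm; apply/skew_spaceP => u v; apply: (mulfI two_neq0).
have fE a b : 2%:R * f a b = fplus f a b + fminus f a b.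
  by rewrite /fplus /fminus; ring.
by rewrite mulrN !fE skp skm -opprD.
Qed.

(** An operator that is skew for f^+ and for f^- = f^+(., sigma .) satisfies
    f^+(u, x sigma v) = f^+(u, sigma x v). *)
Lemma skew_sigma x v : x \in skew_space f -> x (sigma v) = sigma (x v).
Proof.
move=> skx; apply/eqP; rewrite -subr_eq0; apply/eqP/fplus_nondeg => u.
have fplusB a b : fplus f u (a - b) = fplus f u a - fplus f u b.
  by rewrite /fplus linearBl linearBr /= opprD addrACA.
have [sP _] := sigmaP.
rewrite fplusB -[fplus f u (x _)]opprK -(skew_fplus skx) -!sP (skew_fminus skx).
by rewrite opprK subrr.
Qed.

(** Commuting with sigma amounts to F[X]-linearity. *)
Lemma skew_scale x p w :
  x \in skew_space f -> x (chart (p *: w)) = mx_end p%:M (x (chart w)).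
Proof.
move=> skx; elim/poly_ind: p => [|p c IHp].
  rewrite scale0r chart0 linear0 (_ : mx_end _ = 0) ?zero_lfunE //.
  by apply/mx_end_eq0 => i j; rewrite mxE mul0rn dvdp0.
rewrite scalerDl chartD linearD /= mulrC -scalerA -sigmaE skew_sigma // IHp.
rewrite chartZ linearZ /= addrC.
have -> : ('X * p + c%:P)%:M = c%:P *: 1%:M + 'X%:M *m p%:M :> 'M_2.
  by rewrite -scalar_mxM scale_scalar_mx mulr1 raddfD /= addrC.
rewrite mx_end_linear mx_endM add_lfunE scale_lfunE comp_lfunE.
congr (_ *: _ + _).
by have [w' /eqP<-] := chart_surj (x (chart w)); rewrite mx_endE mul1mx.
Qed.

Lemma skew_mx_end x : x \in skew_space f -> exists U, x = mx_end U.
Proof.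
move=> skx; pose U := \matrix_(i, j) chart_lift (x (chart (delta_mx j 0))) i 0.
have UE j : x (chart (delta_mx j 0)) = chart (col j U).
  rewrite -[LHS]chart_liftK; congr chart; apply/matrixP=> i k.
  by rewrite !mxE ord1.
exists U; apply: eq_endP => w; rewrite mx_endE.
have -> : w = \sum_i w i 0 *: delta_mx i 0.
  rewrite [LHS]matrix_sum_delta; apply: eq_bigr => i _.
  by rewrite big_ord1.
rewrite mulmx_sumr !big_ord_recl !big_ord0 !addr0 !chartD linearD /=.
rewrite !skew_scale // !UE !mx_endE !mul_scalar_mx -!scalemxAr -!colE //.
Qed.

Lemma skew_mx_endI U : conjp (U 0 0) = - U 1 1 ->
  conjp (U 0 1) = U 0 1 -> conjp (U 1 0) = U 1 0 -> mx_end U \in skew_space f.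
Proof.
move=> U00 U01 U10.
have U11 : conjp (U 1 1) = - U 0 0.
  by rewrite -[U 1 1]opprK -U00 rmorphN /= conjpK.
have hermU w w' : herm (U *m w) w' = - herm w (U *m w').
  rewrite /herm !mulmx2 !rmorphD !rmorphM /= U00 U01 U10 U11; ring.
apply: skew_spaceE; apply: chartW => w; apply: chartW => w'; rewrite !mx_endE.
  by rewrite !(fplus_chart model) hermU coefN.
by rewrite !(fminus_chart model) hermU coefN scalemxAr.
Qed.

(** The conditions of skew_mx_endI are also necessary, modulo X^n: the form
    herm (U w) w' + herm w (U w') is F[X]-linear in w', so all its coefficients
    below X^n are seen by replacing w' by its multiples by powers of X. *)
Lemma skew_mx_end_dvd U : mx_end U \in skew_space f ->
  [/\ 'X^n %| conjp (U 0 0) + U 1 1, 'X^n %| conjp (U 0 1) - U 0 1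
    & 'X^n %| conjp (U 1 0) - U 1 0].
Proof.
move=> skU.
have dvd_herm w w' : 'X^n %| herm (U *m w) w' + herm w (U *m w').
  apply/dvdp_XnP => i i_lt.
  have := skew_fplus skU (chart w) (chart ('X^(n.-1 - i) *: w')).
  rewrite !mx_endE !(fplus_chart model) => /eqP; rewrite -addr_eq0 -coefD.
  have -> : herm (U *m w) ('X^(n.-1 - i) *: w')
        + herm w (U *m ('X^(n.-1 - i) *: w'))
      = (herm (U *m w) w' + herm w (U *m w')) * 'X^(n.-1 - i).
    by rewrite -scalemxAr /herm !mxE; ring.
  rewrite coefMXn ltnNge leq_subr /= subKn; last first.
    by rewrite -ltnS prednK // ltnW.
  by move/eqP.
have := dvd_herm (delta_mx 1 0) (delta_mx 1 0).
have := dvd_herm (delta_mx 0 0) (delta_mx 0 0).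
have := dvd_herm (delta_mx 0 0) (delta_mx 1 0).
rewrite /herm !mulmx2 !mxE /= !(mulr1, mulr0, addr0, add0r, rmorph0, rmorph1).
rewrite !(mul0r, subr0, sub0r, mul1r, add0r, addr0) ![- _ + _]addrC.
by move=> -> dvd10 ->; split=> //; rewrite -dvdpNr opprB.
Qed.

Lemma current_mx_skew M p : mx_end (current_mx M p) \in skew_space f.
Proof.
(* The half trace is made opaque, so that skewness becomes a ring identity. *)
have trE : M 1 1 = 2%:R * (2%:R^-1 * \tr M) - M 0 0.
  by rewrite mulrA mulfV // mul1r mxtrace2 addrAC subrr add0r.
rewrite /current_mx /gl2_lift; move: (_ * \tr M) trE => c trE.
apply: skew_mx_endI; rewrite !mxE /= (rmorphM (@conjp F)) /= conjp_comp_X2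
  ?mulr0n ?addr0 ?conjpC //.
rewrite rmorphD rmorphM rmorphB /= !conjpC rmorph1 conjpX trE polyCB polyCM.
by rewrite polyC_natr; ring.
Qed.

(** * The isomorphism with the current algebra *)

Local Notation A := {poly %/ ('X^(n./2) : {poly F})}.
Implicit Types (M N : 'M[F]_2) (a b c d : A).

Let half_n_gt0 : (0 < n./2)%N. Proof. by rewrite half_gt0. Qed.

Let in_qpoly_dvd p :
  'X^n %| (p \Po 'X^2) - ((in_qpoly ('X^(n./2)) p : {poly F}) \Po 'X^2).
Proof. by have := in_qpoly_comp half_n_gt0 p; rewrite even_halfK. Qed.

Definition current_skew M a : skew_lie f :=
  vsproj (skew_space f) (mx_end (current_mx M a)).

Lemma current_skewE M a : vsval (current_skew M a) = mx_end (current_mx M a).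
Proof. by rewrite vsprojK // current_mx_skew. Qed.

Fact current_skew_bilinear : bilinear_for *:%R *:%R current_skew.
Proof.
split=> [a|M] k x y; apply: subvs_inj; rewrite linearP /= !current_skewE.
  by rewrite current_mx_linearl mx_end_linear.
by rewrite current_mx_linearr mx_end_linear.
Qed.
HB.instance Definition _ :=
  bilinear_isBilinear.Build F 'M[F]_2 A (skew_lie f) *:%R *:%R current_skew
    current_skew_bilinear.

Definition current_hom : 'Hom(current 'M[F]_2 n./2, skew_lie f) :=
  linfun (tensor_lift current_skew : current 'M[F]_2 n./2 -> skew_lie f).

Lemma current_homE M a : current_hom (tens M a) = current_skew M a.
Proof. by rewrite lfunE /= tensor_liftE. Qed.

(** The product in F[X]/(X^(n/2)) is a product of polynomials up to a multiple
    of X^(n/2), which becomes a multiple of X^n in X^2. *)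
Lemma current_hom_bracket s t :
  current_hom [Lie s, t] = [Lie current_hom s, current_hom t].
Proof.
elim/tensor_ind: s t => [M a|s1 s2 IH1 IH2] t; last first.
  by rewrite bracketDl !linearD /= bracketDl IH1 IH2.
elim/tensor_ind: t => [N b|t1 t2 IH1 IH2]; last first.
  by rewrite bracketDr !linearD /= bracketDr IH1 IH2.
rewrite [X in current_hom X]current_bracket_tens !current_homE.
apply: subvs_inj; rewrite current_skewE skew_bracketE !current_skewE.
rewrite bracket_mx_end.
rewrite /current_mx -!scalemxAl -!scalemxAr !scalerA.
rewrite [(_ \Po _) * ((a : {poly F}) \Po _)]mulrC -scalerBr gl2_lift_bracket.
rewrite gl2_lift_tr0 ?tr_bracket //; apply/mx_end_eq => i j.
rewrite [in X in _ %| X]mxE [X in _ - X]mxE -mulrBl dvdp_mulr // -dvdpNr opprB.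
by rewrite -rmorphM in_qpoly_dvd.
Qed.

Lemma current_hom_comb a b c d :
  vsval (current_hom (gl2_comb a b c d)) = mx_end (comb_mx a b c d).
Proof.
have mx_endD U U' : mx_end (U + U') = mx_end U + mx_end U'.
  by have := mx_end_linear 1 U U'; rewrite !scale1r.
by rewrite !linearD /= !current_homE !current_skewE -!mx_endD.
Qed.

(** By skew_mx_end_dvd, modulo X^n, the off-diagonal entries of a matrix in L(f)
    are even, and the diagonal ones have the same odd part and opposite even
    parts. *)
Lemma skew_current_hom (x : skew_lie f) : exists t, current_hom t = x.
Proof.
have [U xE] := skew_mx_end (subvsP x).
have := subvsP x; rewrite xE => /skew_mx_end_dvd[dvd00 dvd01 dvd10].
pose ev p : A := in_qpoly ('X^(n./2)) (even_poly p).
pose od p : A := in_qpoly ('X^(n./2)) (odd_poly p).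
have [E00 E11 E01 E10] :=
  comb_mxE two_neq0 (ev (U 0 0)) (od (U 0 0)) (ev (U 0 1)) (ev (U 1 0)).
exists (gl2_comb (ev (U 0 0)) (od (U 0 0)) (ev (U 0 1)) (ev (U 1 0))).
apply: subvs_inj; rewrite current_hom_comb xE; apply/mx_end_eq.
have evP p := in_qpoly_dvd (even_poly p).
have odP p := in_qpoly_dvd (odd_poly p).
have even_conj p :
    'X^n %| conjp p - p -> 'X^n %| (ev p : {poly F}) \Po 'X^2 - p.
  have -> : conjp p - p = - (2%:R *: ((odd_poly p \Po 'X^2) * 'X)).
    rewrite conjp_even_odd -[X in _ - X]poly_even_odd -mul_polyC polyC_natr.
    ring.
  rewrite dvdpNr dvdpZr // => /(dvdp_add (evP p)) dvd_sum.
  rewrite -dvdpNr -[X in _ - X]poly_even_odd; move: dvd_sum.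
  by congr (_ %| _); ring.
elim/ord2P; elim/ord2P.
- rewrite E00 -[X in _ - X]poly_even_odd -dvdpNr.
  have := dvdp_add (evP (U 0 0)) (dvdp_mulr 'X (odP (U 0 0))).
  by congr (_ %| _); ring.
- by rewrite E01 even_conj.
- by rewrite E10 even_conj.
rewrite E11; rewrite conjp_even_odd in dvd00.
have := dvdp_sub (dvdp_sub (evP (U 0 0)) (dvdp_mulr 'X (odP (U 0 0)))) dvd00.
by congr (_ %| _); ring.
Qed.

(** The entries of comb_mx determine its four arguments, whose substitutions by
    X^2 have too small a degree to be multiples of X^n. *)
Lemma current_hom_inj : injective current_hom.
Proof.
apply/lker0P; rewrite -subv0; apply/subvP=> t; rewrite memv_ker memv0.
move=> /eqP t0; have [a [b [c [d tE]]]] := gl2_combE two_neq0 t.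
have := current_hom_comb a b c d.
rewrite -tE t0 linear0 => /esym/mx_end_eq0 dvdU.
have [E00 E11 E01 E10] := comb_mxE two_neq0 a b c d.
have nE := even_halfK n_even.
have two_dvd p : 'X^n %| 2%:R * p -> 'X^(n./2.*2) %| p.
  by rewrite nE -polyC_natr mul_polyC dvdpZr.
have a0 : a = 0.
  apply: (qpoly_comp_eq0 half_n_gt0); apply: two_dvd.
  have := dvdp_sub (dvdU 0 0) (dvdU 1 1); rewrite E00 E11.
  by congr (_ %| _); ring.
have b0 : b = 0.
  apply: (qpoly_compX_eq0 half_n_gt0); apply: two_dvd.
  have := dvdp_add (dvdU 0 0) (dvdU 1 1); rewrite E00 E11.
  by congr (_ %| _); ring.
have c0 : c = 0 by apply: (qpoly_comp_eq0 half_n_gt0); rewrite nE -E01.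
have d0 : d = 0 by apply: (qpoly_comp_eq0 half_n_gt0); rewrite nE -E10.
by rewrite tE a0 b0 c0 d0 /gl2_comb !linear0r !addr0.
Qed.

Definition skew_iso : 'Hom(skew_lie f, current 'M[F]_2 n./2) :=
  (current_hom^-1)%VF.

Lemma current_homK : cancel current_hom skew_iso.
Proof. exact/lker0_lfunK/lker0P/current_hom_inj. Qed.

Lemma skew_isoK : cancel skew_iso current_hom.
Proof.
by move=> x; have [t <-] := skew_current_hom x; rewrite current_homK.
Qed.

Lemma skew_lie_isomorphic : lie_isomorphic (skew_lie f) (current 'M[F]_2 n./2).
Proof.
exists skew_iso; split; first exact: Bijective skew_isoK current_homK.
by move=> x y; apply: current_hom_inj; rewrite current_hom_bracket !skew_isoK.
Qed.

Lemma dim_skew_space : \dim (skew_space f) = (2 * n)%N.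
Proof.
have -> : \dim (skew_space f) = \dim {:skew_lie f} by rewrite dimvf.
have -> : ({:skew_lie f} = current_hom @: fullv)%VS.
  apply/esym/eqP; rewrite eqEsubv subvf /=; apply/subvP=> x _.
  by have [t <-] := skew_current_hom x; rewrite memv_img ?memvf.
rewrite limg_dim_eq; last first.
  by apply/eqP; rewrite (eqP (introT lker0P current_hom_inj)) capv0.
by rewrite dimvf dim_current_gl2 // -mulnA (mul2n n./2) even_halfK.
Qed.

(** * The ideal K and reductivity *)

Local Notation K := (skew_to_kill f (lker (sigma \o sigma)%VF)).

Lemma skew_to_kill_abelian (W : {vspace V}) : lie_abelian (skew_to_kill f W).
Proof.
move=> a b /skew_to_killP[aW aW0] /skew_to_killP[bW bW0].
apply: subvs_inj; rewrite skew_bracketE linear0; apply/lfunP => v.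
by rewrite commutatorE zero_lfunE aW0 // bW0 // subrr.
Qed.

(** As L(f) commutes with sigma, it preserves the kernel of sigma^2. *)
Lemma skew_to_kill_ideal : lie_ideal K.
Proof.
move=> a b /skew_to_killP[bW bW0].
have stable v : v \in lker (sigma \o sigma)%VF ->
    vsval a v \in lker (sigma \o sigma)%VF.
  rewrite !memv_ker !comp_lfunE -!skew_sigma ?subvsP // => /eqP->.
  by rewrite linear0.
apply/skew_to_killP; split=> v => [|vW]; rewrite skew_bracketE commutatorE.
  by rewrite rpredB ?bW // stable.
by rewrite (bW0 v) // (bW0 (vsval a v)) ?stable // linear0 subrr.
Qed.

(** The witness is X^(n-2) e, whose bracket with h is 2 X^(n-2) e.  It maps V
    into X^(n-2) V, the kernel of sigma^2, and it kills that kernel because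
    2 (n - 2) >= n. *)
Lemma skew_to_kill_not_central : (2 < n)%N -> ~ lie_central K.
Proof.
move=> n_gt2 cK.
have half_gt0 : (0 < n./2)%N by rewrite half_gt0.
pose a : A := in_qpoly ('X^(n./2)) 'X^((n./2).-1).
have aE : (a : {poly F}) \Po 'X^2 = 'X^(n - 2).
  rewrite [polyn a]in_qpoly_small; last first.
    by rewrite mk_monic_Xn !size_polyXn prednK // ltnS prednK.
  rewrite rmorphXn /= comp_polyX -exprM; congr (_ ^+ _).
  by rewrite mul2n -subn1 doubleB even_halfK.
pose x := current_hom (tens (delta_mx 0 1) a).
have tr01 : \tr (delta_mx 0 1 : 'M[F]_2) = 0 by exact: mxtrace_delta.
have xE w : vsval x (chart w)
    = chart ('X^(n - 2) *: (map_mx polyC (delta_mx 0 1) *m w)).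
  rewrite /x current_homE current_skewE mx_endE /current_mx aE gl2_lift_tr0 //.
  by rewrite -scalemxAl.
have n_ge4 : (4 <= n)%N.
  have : n != 3 by apply: contraNneq n_even => ->.
  by move=> /eqP; lia.
have X2 m : (2 <= m)%N -> 'X * ('X * 'X^(m - 2)) = 'X^m :> {poly F}.
  by move=> m_ge2; rewrite -!exprS -addn2 subnK.
have xK : x \in K.
  apply/skew_to_killP.
  split; elim/chartW => w; rewrite ?memv_ker ?comp_lfunE xE.
    by rewrite !sigmaE !scalerA -mulrA X2 // (chart_Xn model) eqxx.
  rewrite !sigmaE => /eqP/chart_eq0 dvdw; apply/chart_eq0 => i.
  (* X^2 w_j is a multiple of X^n, and X^(n-2) = X^(n-4) X^2. *)
  have dvdXw j : 'X^n %| 'X^(n - 2) * w j 0.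
    rewrite -X2 1?leq_subRL //.
    have -> : 'X * ('X * 'X^(n - 2 - 2)) * w j 0
        = 'X^(n - 2 - 2) * ('X *: ('X *: w)) j 0.
      by rewrite !mxE; ring.
    exact: dvdp_mull.
  by rewrite mxE mulmx2 mulrDr dvdp_add // mulrCA dvdp_mull.
have /(congr1 vsval) := cK _ (current_hom (tens (sl2_h F) (1 : A))) xK.
rewrite bracketC -current_hom_bracket [X in current_hom X]current_bracket_tens.
rewrite current_homE linear0 linearN /= current_skewE => /eqP.
rewrite oppr_eq0 => /eqP/mx_end_eq0/(_ 0 1); rewrite mul1r.
have [-> _ _] := gl2_brackets F.
rewrite /current_mx aE gl2_lift_tr0 ?mxtraceZ ?tr01 ?mulr0 //.
rewrite !mxE /= mulr1.
move=> /dvdp_XnP/(_ (n - 2)%N); rewrite coefMC coefXn eqxx mul1r => two0.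
by move/eqP: two_neq0; apply; apply: two0; lia.
Qed.

Lemma skew_lie_reductive : n = 2%N -> reductive (skew_lie f).
Proof.
move=> n2; pose hom1 M := current_hom (tens M (1 : A)).
have homB M N : [Lie hom1 M, hom1 N] = hom1 [Lie M, N].
  rewrite -current_hom_bracket [X in current_hom X]current_bracket_tens.
  by rewrite mulr1.
have homZ k M : hom1 (k *: M) = k *: hom1 M.
  by rewrite /hom1 linearZl_LR linearZ.
have [he hg eg] := gl2_brackets F.
apply: (@gl2_reductive F _ (hom1 1%:M) (hom1 (sl2_h F))
          (hom1 (delta_mx 0 1)) (hom1 (delta_mx 1 0))); rewrite ?homB -?homZ //.
- move=> x; have [t <-] := skew_current_hom x; rewrite -current_hom_bracket.
  elim/tensor_ind: t => [M a|s t IHs IHt]; last first.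
    by rewrite bracketDr linearD /= IHs IHt addr0.
  rewrite [X in current_hom X]current_bracket_tens.
  rewrite (_ : [Lie 1%:M, M] = 0) ?linear0l ?linear0 //.
  by rewrite /bracket /= /mx_commutator mul1mx mulmx1 subrr.
- apply/eqP => /(congr1 vsval); rewrite linear0 /hom1 current_homE.
  rewrite current_skewE => /mx_end_eq0/(_ 0 0).
  rewrite /current_mx comp_polyC scale1r gl2_lift_tr0 ?mxtrace_sl2_h //.
  rewrite !mxE /= subr0 => /dvdp_XnP/(_ 0%N (ltnW n_gt1)); rewrite coefC eqxx.
  by move/eqP; rewrite oner_eq0.
- by rewrite he.
- by rewrite hg.
- by rewrite eg.
have scalar a : a = a`_0 *: 1.
  apply/val_inj/polyP => -[|i]; rewrite coefZ coefC ?mulr1 // mulr0.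
  by rewrite big_coef_npoly // mk_monic_Xn size_polyXn n2.
move=> x; have [t <-] := skew_current_hom x.
have [a [b [c [d ->]]]] := gl2_combE two_neq0 t.
exists a`_0, b`_0, c`_0, d`_0; rewrite -!homZ /hom1 -!linearD /=.
by rewrite !linearZl_LR -!linearZr_LR /= -!scalar.
Qed.

Lemma reductive_skew_lieP : reductive (skew_lie f) <-> n = 2%N.
Proof.
split=> [redL|]; last exact: skew_lie_reductive.
apply/eqP; rewrite eqn_leq n_gt1 andbT leqNgt; apply/negP => n_gt2.
apply: (skew_to_kill_not_central n_gt2).
apply: redL; first exact: skew_to_kill_ideal.
exists 1%N; apply/eqP; rewrite -subv0; apply/lie_prodP => a b aK bK.
by rewrite (skew_to_kill_abelian aK bK) mem0v.
Qed.

End Structure.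

Theorem proposition8p1 (F : fieldType) (n : nat) (V : vectType F)
    (f : {biscalar V}) (e : (n + n).-tuple V) :
    2%N \notin [pchar F] -> (2 <= n)%N -> ~~ odd n ->
    basis_of {:V} e ->
    (forall i j : 'I_(n + n), f (tnth e i) (tnth e j) = gram_A n 1 i j) ->
  [/\ \dim (skew_space f) = (2 * n)%N,
      lie_isomorphic (skew_lie f) (current 'M[F]_2 n./2),
      reductive (skew_lie f) <-> n = 2%N &
      exists2 sigma : 'End(V), unique (is_sigma f) sigma &
        let W := lker (sigma \o sigma)%VF in
        let K := skew_to_kill f W in
        [/\ lie_abelian K, lie_ideal K & (2 < n)%N -> ~ lie_central K]].
Proof.
move=> char2 n_gt1 n_even basis_e gram.
have two_neq0 : 2%:R != 0 :> F.
  by apply: contra char2 => two0; rewrite !inE two0.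
have dimV : \dim {:V} = (n + n)%N by rewrite -(size_basis basis_e).
have model := gram_chart_model two_neq0 n_gt1 n_even gram.
split.
- exact: dim_skew_space model.
- exact: skew_lie_isomorphic model.
- exact: reductive_skew_lieP model.
exists (sigma n_gt1 dimV model); first exact: sigmaP.
split; [exact: skew_to_kill_abelian | exact: skew_to_kill_ideal |].
exact: skew_to_kill_not_central.
Qed.
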